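(* Let $n\ge3$ and let $\{A^{(k)}\}_{k\in\mathbb{N}}$ be a sequence of matrices in $\mathcal{A}_2$. For each fixed $k$, let $\lambda_1^{(k)}\le\lambda_2^{(k)}\le\dots\le\lambda_n^{(k)}$ be the eigenvalues of $A^{(k)}$. Then, the following hold: (i) If $\lambda_1^{(k)}\to0$ as $k\to\infty$, then $\lambda_j^{(k)}\to\infty$ as $k\to\infty$ for all $2\le j\le n$, all at the same rate, in the sense that $\lambda_j^{(k)}/\lambda_n^{(k)}\to1$ as $k\to\infty$. (ii) If $\lambda_n^{(k)}\to\infty$ as $k\to\infty$, then: (a) either $\lambda_1^{(k)}$ remains bounded and $\lambda_j^{(k)}\to\infty$ as $k\to\infty$ for all $2\le j\le n$; (b) or $\lambda_j^{(k)}\to\infty$ as $k\to\infty$ for all $j$.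
   Context: $\mathcal{S}^n_+$ is the set of symmetric positive definite real $n\times n$ matrices; eigenvalues are counted with multiplicity. For $\zeta\in\mathbb{R}^n$, $\sigma_1(\zeta)=\sum_i\zeta_i$, $\sigma_2(\zeta)=\sum_{i<j}\zeta_i\zeta_j$, and $\Gamma_2=\{\zeta\in\mathbb{R}^n:\sigma_1(\zeta)>0,\ \sigma_2(\zeta)>0\}$. The class $\mathcal{A}_2$ is $$\mathcal{A}_2=\Big\{A\in\mathcal{S}^n_+:\ \lambda_i(A)^2=\sum_{j\ne i}\zeta_j\ (i=1,\dots,n)\ \text{for some }\zeta\in\Gamma_2\text{ with }\sigma_2(\zeta)=1\Big\},$$ where $\lambda_1(A),\dots,\lambda_n(A)$ are the eigenvalues of $A$.
   Formalization: In (ii), the alternative (a)/(b) fails for a whole sequence whose λ_1 oscillates; it is proved instead that λ_j→∞ for all 2≤j≤n along the whole sequence, and that every subsequence has a further subsequence along which (a) or (b) holds. *)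

(* Defs.v *)
From HB Require Import structures.
From mathcomp Require Import all_boot all_order all_algebra.
From mathcomp Require Import all_classical all_reals all_analysis.
Import Order.TTheory GRing.Theory Num.Theory.
Import numFieldNormedType.Exports.

Set Implicit Arguments.
Unset Strict Implicit.
Unset Printing Implicit Defensive.

Local Open Scope classical_set_scope.
Local Open Scope ring_scope.

Definition sym_posdef (R : realType) (n : nat) (A : 'M[R]_n) : Prop :=
  A^T = A /\ forall v : 'rV[R]_n, v != 0 -> 0 < (v *m A *m v^T) 0 0.

(* [s] lists the eigenvalues of [A], in some order, each repeated according to
   its multiplicity as a root of the characteristic polynomial. *)
Definition eigenvalues (R : realType) (n : nat) (A : 'M[R]_n)
    (s : n.-tuple R) : Prop :=
  char_poly A = \prod_(x <- s) ('X - x%:P).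

Definition sigma1 (R : realType) (n : nat) (zeta : 'rV[R]_n) : R :=
  \sum_(i < n) zeta 0 i.

Definition sigma2 (R : realType) (n : nat) (zeta : 'rV[R]_n) : R :=
  \sum_(i < n) \sum_(j < n | (i < j)%N) zeta 0 i * zeta 0 j.

Definition Gamma2 (R : realType) (n : nat) : set 'rV[R]_n :=
  [set zeta | 0 < sigma1 zeta /\ 0 < sigma2 zeta].

(* The order in which the eigenvalues are listed is immaterial: [zeta] can be
   permuted along with [s]. *)
Definition A2 (R : realType) (n : nat) : set 'M[R]_n :=
  [set A | sym_posdef A /\
    exists (s : n.-tuple R) (zeta : 'rV[R]_n),
      [/\ eigenvalues A s, Gamma2 zeta, sigma2 zeta = 1 &
          forall i : 'I_n, tnth s i ^+ 2 = \sum_(j < n | j != i) zeta 0 j]].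

(* [lam j k] is the [j]-th smallest eigenvalue of the [k]-th matrix, for
   1 <= j <= n; the other values of [j] are not used. *)
Definition dichotomy (R : realType) (n : nat) (lam : nat -> nat -> R) : Prop :=
  (bounded_fun (lam 1%N) /\
     forall j : nat, (2 <= j <= n)%N -> lam j k @[k --> \oo] --> +oo) \/
  (forall j : nat, (1 <= j <= n)%N -> lam j k @[k --> \oo] --> +oo).

(* Main.v *)
Require Import Defs.
From HB Require Import structures.
From mathcomp Require Import all_boot all_order all_algebra.
From mathcomp Require Import all_fingroup.
From mathcomp Require Import all_classical all_reals all_analysis.
From mathcomp Require Import lra.
Import Order.TTheory GRing.Theory Num.Theory.
Import numFieldNormedType.Exports.

(** Write mu_i = lambda_i^2 and S = sigma_1(zeta), so that zeta_i = S - mu_i.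
    The constraint sigma_2(zeta) = 1 says sum_i zeta_i^2 = S^2 - 2, and keeping
    only two terms of the sum gives, for any two distinct indices,
      (S - mu_i)^2 + (S - mu_j)^2 <= S^2 - 2        [A2_sum_sqr].
    For i = 1, the smallest eigenvalue, this reads
      2 + mu_1^2 + (S - mu_j)^2 <= 2 S mu_1,
    and two things follow at once: S mu_1 >= 1, so S blows up when mu_1 tends
    to 0, and (S - mu_j)^2 <= 2 S mu_1, so that every other mu_j stays close to
    the same number S. More precisely |S - mu_j| <= 2 S mu_1, while mu_1 <= mu_j
    turns the same inequality into S <= 4 mu_j, and mu_j <= 2 S
    [zeta_pair_bounds].

    Eliminating S leaves estimates between the eigenvalues of one matrix, with
    constants that do not even depend on n [A2_eigenvalue_bounds]:
      1 <= 2 lambda_1 lambda_j,    lambda_n <= 3 lambda_j,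
      lambda_n - lambda_j <= 16 lambda_1^2 lambda_n      (2 <= j <= n).
    The first and third give (i), the second gives the divergence of all
    lambda_j with j >= 2 in (ii). As for lambda_1, along any subsequence it is
    either bounded, or tends to infinity along a further subsequence and drags
    the larger eigenvalues with it [unbounded_subseq]. *)

Set Implicit Arguments.
Unset Strict Implicit.

Local Open Scope classical_set_scope.
Local Open Scope ring_scope.

(** If v is an eigenvector for x, then v A v^T = x |v|^2. *)
Lemma posdef_eigenvalue_gt0 (R : realType) (n : nat) (A : 'M[R]_n)
    (s : n.-tuple R) (x : R) :
  sym_posdef A -> eigenvalues A s -> x \in (s : seq R) -> 0 < x.
Proof.
move=> [_ Apos] As xs.
have : eigenvalue A x.
  by rewrite eigenvalue_root_char (As : char_poly A = _) root_prod_XsubC.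
move=> /eigenvalueP[v vA v0]; have := Apos v v0.
rewrite vA -scalemxAl mxE mxE.
have : 0 <= \sum_j v 0 j * v^T j 0.
  by apply: sumr_ge0 => j _; rewrite mxE -expr2 sqr_ge0.
move=> vv_ge0 xvv_gt0; rewrite ltNge; apply/negP => x_le0.
by have := mulr_le0_ge0 x_le0 vv_ge0; rewrite leNgt xvv_gt0.
Qed.

Lemma sigma1_sqr (R : realType) (n : nat) (z : 'rV[R]_n) :
  sigma1 z ^+ 2 = \sum_(i < n) z 0 i ^+ 2 + sigma2 z *+ 2.
Proof.
have sigma2_sym : \sum_(i < n) \sum_(j < n | (j < i)%N) z 0 i * z 0 j = sigma2 z.
  rewrite (exchange_big_dep xpredT) //=; apply: eq_bigr => i _.
  by apply: eq_bigr => j _; rewrite mulrC.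
rewrite expr2 big_distrlr /= mulr2n -[X in _ + (X + _)]sigma2_sym /sigma2.
rewrite -!big_split /=; apply: eq_bigr => i _.
rewrite (bigID (fun j : 'I_n => (j < i)%N)) /= addrCA; congr (_ + _).
rewrite (bigD1 i) ?ltnn //= -expr2; congr (_ + _); apply: eq_bigl => j.
by rewrite -leqNgt ltn_neqAle andbC eq_sym.
Qed.

(** Here S is sigma_1(zeta). The listing [s] may differ from the one that
    defines the class by a permutation, under which a pair of distinct indices
    goes to a pair of distinct indices; the two terms on the left are then two
    of the squares zeta_i^2, whose total is S^2 - 2. *)
Lemma A2_sum_sqr (R : realType) (n : nat) (A : 'M[R]_n) (s : n.-tuple R) :
  A2 A -> eigenvalues A s ->
  exists2 S : R, 0 < S & forall i j : 'I_n, i != j ->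
    (S - tnth s i ^+ 2) ^+ 2 + (S - tnth s j ^+ 2) ^+ 2 <= S ^+ 2 - 2.
Proof.
move=> [_ [t [z [At [S_gt0 _] z2 tz]]]] As.
have /tuple_permP[p sE] : perm_eq s t.
  by apply: prod_XsubC_eq; rewrite -(As : char_poly A = _) (At : char_poly A = _).
have szE i : sigma1 z - tnth s i ^+ 2 = z 0 (p i).
  have -> : tnth s i = tnth t (p i).
    by rewrite (tnth_nth 0) sE -tnth_nth tnth_mktuple.
  by rewrite tz /sigma1 (bigD1 (p i)) //= addrK.
exists (sigma1 z) => // i j ij; rewrite !szE sigma1_sqr z2 addrK.
rewrite (bigD1 (p i)) //= lerD2l (bigD1 (p j)) /=; last first.
  by rewrite (inj_eq perm_inj) eq_sym.
by rewrite lerDl sumr_ge0 // => k _; rewrite sqr_ge0.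
Qed.

(** With a = mu_1 and b = mu_j, the hypothesis reads
    2 + a^2 + (S - b)^2 <= 2 S a, whence 1 <= S a and (S - b)^2 <= 2 S a.
    The last bound uses the former in the form 2 S a <= (2 S a)^2. *)
Lemma zeta_pair_bounds (R : realType) (S a b : R) :
  0 < S -> 0 < a -> a <= b -> (S - a) ^+ 2 + (S - b) ^+ 2 <= S ^+ 2 - 2 ->
  [/\ 1 <= S * a, S <= 4 * b, b <= 2 * S & `|S - b| <= 2 * (S * a)].
Proof.
move=> S_gt0 a_gt0 ab H.
have b_gt0 : 0 < b by lra.
have Sa_ge0 := sqr_ge0 (S - a); have Sb_ge0 := sqr_ge0 (S - b).
have a2_ge0 := sqr_ge0 a.
have Sa1 : 1 <= S * a by lra.
have bS : (S - b) ^+ 2 <= 2 * (S * a) by lra.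
split => //.
- (* Multiply S <= 4 * b by S: S^2 - 2 S b <= 2 S a <= 2 S b. *)
  have Sab : S * a <= S * b by rewrite ler_pM2l.
  by rewrite -(ler_pM2l S_gt0); nra.
- have Sb2 : (S - b) ^+ 2 <= S ^+ 2 by lra.
  by rewrite -(ler_pM2l b_gt0); lra.
- rewrite -(@ler_pXn2r _ 2) ?nnegrE ?normr_ge0 //; last by lra.
  by rewrite real_normK ?num_real //; nra.
Qed.

(** The bounds of [zeta_pair_bounds] for the pairs (1, j) and (1, n), which
    share the same S, with S eliminated between them. *)
Lemma A2_eigenvalue_bounds (R : realType) (n : nat) (A : 'M[R]_n)
    (s : n.-tuple R) (j : nat) :
  A2 A -> eigenvalues A s -> sorted <=%R s -> (0 < j < n)%N ->
  let x := nth 0 s 0 in let y := nth 0 s j in let z := nth 0 s n.-1 in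
  [/\ [/\ 0 < x, x <= y & y <= z],
      1 <= 2 * x * y, z <= 3 * y & z - y <= 16 * x ^+ 2 * z].
Proof.
move=> AA As s_sorted /andP[j_gt0 jn] x y z.
have n_gt0 : (0 < n)%N by apply: leq_trans jn.
have n1_lt : (n.-1 < n)%N by rewrite prednK.
have jn1 : (j <= n.-1)%N by rewrite -ltnS prednK.
have nth_le i k : (i <= k)%N -> (k < n)%N -> nth 0 s i <= nth 0 s k.
  move=> ik kn; apply: (sorted_leq_nth le_trans lexx 0 s_sorted) => //;
    rewrite ?inE ?size_tuple //.
  exact: leq_ltn_trans kn.
have x_gt0 : 0 < x.
  have [Apos _] := AA.
  by apply: (posdef_eigenvalue_gt0 Apos As); apply: mem_nth; rewrite size_tuple.
have xy : x <= y by apply: nth_le.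
have yz : y <= z by apply: nth_le.
have [S S_gt0 HS] := A2_sum_sqr AA As.
have bounds k (k_gt0 : (0 < k)%N) (kn : (k < n)%N) (w := nth 0 s k) :
    [/\ 1 <= S * x ^+ 2, S <= 4 * w ^+ 2, w ^+ 2 <= 2 * S
      & `|S - w ^+ 2| <= 2 * (S * x ^+ 2)].
  have xw : x <= w by apply: nth_le.
  apply: zeta_pair_bounds => //; first by rewrite exprn_gt0.
  - by rewrite lerXn2r // nnegrE; lra.
  - have := HS (Ordinal n_gt0) (Ordinal kn); rewrite !(tnth_nth 0); apply.
    by rewrite -val_eqE /= neq_ltn k_gt0.
have [Sx Sy _ Syx] := bounds _ j_gt0 jn.
have [_ Sz zS Szx] := bounds _ (leq_trans j_gt0 jn1) n1_lt.
rewrite -/y in Sy Syx; rewrite -/z in Sz zS Szx.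
split => //.
- have : S * x ^+ 2 <= 4 * y ^+ 2 * x ^+ 2 by rewrite ler_wpM2r ?sqr_ge0.
  have : 0 < x * y by rewrite mulr_gt0 // (lt_le_trans x_gt0).
  by nra.
- have : z ^+ 2 <= 8 * y ^+ 2 by lra.
  have : 0 < y by lra.
  by nra.
- (* Both y^2 and z^2 are within 2 S x^2 of S, and S <= 4 z^2; then pass from
     squares to z - y using z^2 - y^2 >= (z - y) z. *)
  have d : z ^+ 2 - y ^+ 2 <= 16 * x ^+ 2 * z ^+ 2.
    move: Syx Szx; rewrite !ler_norml => /andP[? ?] /andP[? ?].
    have : x ^+ 2 * S <= x ^+ 2 * (4 * z ^+ 2) by rewrite ler_wpM2l ?sqr_ge0.
    by lra.
  have z_gt0 : 0 < z by lra.
  by rewrite -(ler_pM2r z_gt0); nra.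
Qed.

Lemma homo_ltn_ge_id (f : nat -> nat) (k : nat) :
  {homo f : k l / (k < l)%N} -> (k <= f k)%N.
Proof.
by move=> f_incr; elim: k => // k /leq_ltn_trans; apply; apply: f_incr.
Qed.

Lemma homo_ltn_cvg (f : nat -> nat) :
  {homo f : k l / (k < l)%N} -> f k @[k --> \oo] --> \oo.
Proof.
move=> f_incr; apply/cvgnyPge => M; exists M => // k /= /leq_trans; apply.
exact: homo_ltn_ge_id.
Qed.

(** A subsequence tending to infinity must be chosen among arbitrarily late
    terms; a term exceeding k plus the sum of the first k + 1 terms is
    automatically one with index greater than k. *)
Lemma unbounded_subseq (R : realType) (u : nat -> R) :
  (forall k, 0 <= u k) -> ~ bounded_fun u ->
  exists2 psi : nat -> nat, {homo psi : k l / (k < l)%N} &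
    u (psi k) @[k --> \oo] --> +oo.
Proof.
move=> u_ge0 u_unbounded.
have u_large (M : R) : exists k, M < u k.
  apply: contrapT => /forallNP H; apply: u_unbounded.
  exists M; split=> [|N MN k _ /=]; first exact: num_real.
  rewrite ger0_norm // (le_trans _ (ltW MN)) // leNgt.
  by apply/negP/H.
(* Requiring u (f k.+1) > f k suffices for divergence, as f k >= k. *)
have [|f [_ fS]] :=
    @dependent_choice nat (fun k l => (k < l)%N /\ k%:R < u l) _ 0%N.
  move=> k; apply: cid; have [l] := u_large (k%:R + \sum_(i < k.+1) u i).
  move=> ul; exists l; split.
    rewrite ltnNge; apply/negP => lk; move: ul.
    rewrite (bigD1 (Ordinal (lk : (l < k.+1)%N))) //= addrCA gtrDl ltNge.
    by rewrite addr_ge0 // sumr_ge0.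
  by apply: le_lt_trans ul; rewrite lerDl sumr_ge0.
have f_incr : {homo f : k l / (k < l)%N}.
  by apply: (homo_ltn ltn_trans) => k; exact: (fS k).1.
exists (f \o S) => [k l kl|]; first exact: f_incr.
apply: (ger_cvgy _ cvgr_idn).
apply: nearW => k; apply: le_trans (ltW (fS k).2).
by rewrite ler_nat homo_ltn_ge_id.
Qed.

Unset Implicit Arguments.
Set Strict Implicit.

Theorem corollary3p6 (R : realType) (n : nat) (hn : (3 <= n)%N)
    (A : nat -> 'M[R]_n) (hA : forall k : nat, A2 (A k))
    (s : nat -> n.-tuple R)
    (hs : forall k : nat, eigenvalues (A k) (s k))
    (s_sorted : forall k : nat, sorted <=%R (s k)) :
  let lam (j k : nat) : R := nth 0 (s k) j.-1 in
  (lam 1%N k @[k --> \oo] --> (0 : R) ->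
     forall j : nat, (2 <= j <= n)%N ->
       (lam j k @[k --> \oo] --> +oo) /\
       (lam j k / lam n k @[k --> \oo] --> (1 : R))) /\
  (lam n k @[k --> \oo] --> +oo ->
     (forall j : nat, (2 <= j <= n)%N -> lam j k @[k --> \oo] --> +oo) /\
     (forall phi : nat -> nat, {homo phi : k l / (k < l)%N} ->
        exists2 psi : nat -> nat, {homo psi : k l / (k < l)%N} &
          dichotomy n (fun j k => lam j (phi (psi k))))).
Proof.
move=> lam.
have bounds j k (j2n : (2 <= j <= n)%N) :
    [/\ [/\ 0 < lam 1%N k, lam 1%N k <= lam j k & lam j k <= lam n k],
        1 <= 2 * lam 1%N k * lam j k, lam n k <= 3 * lam j k
      & lam n k - lam j k <= 16 * lam 1%N k ^+ 2 * lam n k].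
  apply: A2_eigenvalue_bounds (hA k) (hs k) (s_sorted k) _.
  by case: j j2n => [|[|j]].
split=> [lam1_to0 j j2n|lamn_toy].
  split.
    apply/cvgryPge => M.
    have M1_gt0 : 0 < `|M| + 1 by rewrite ltr_wpDl.
    have eps_gt0 : 0 < (2 * (`|M| + 1))^-1 by rewrite invr_gt0 mulr_gt0.
    move/cvgr0Pnorm_lt : lam1_to0 => /(_ _ eps_gt0); apply: filterS => k.
    have [[x_gt0 xy _] xy1 _ _] := bounds j k j2n.
    rewrite gtr0_norm // -[ltRHS]mul1r ltr_pdivlMr ?mulr_gt0 // => xM.
    by have := ler_norm M; nra.
  (* The third bound, divided by lam n k. *)
  apply: (@squeeze_cvgr _ _ _ _ (fun k => 1 - 16 * lam 1%N k ^+ 2) (fun=> 1)).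
  - apply: nearW => k; have [[x_gt0 xy yz] _ _ zy] := bounds j k j2n.
    have z_gt0 : 0 < lam n k by lra.
    by rewrite ler_pdivlMr // ler_pdivrMr // mul1r yz andbT; lra.
  - rewrite -[X in _ --> X]subr0 -[X in _ --> _ - X](mulr0 16).
    apply: cvgB; first exact: cvg_cst.
    apply: cvgMr; rewrite -[X in _ --> X](mulr0 0); exact: cvgM.
  - exact: cvg_cst.
have lamj_toy j : (2 <= j <= n)%N -> lam j k @[k --> \oo] --> +oo.
  move=> j2n; apply/cvgryPge => M.
  move/cvgryPge : lamn_toy => /(_ (3 * M)); apply: filterS => k.
  by have [_ _ zy _] := bounds j k j2n; lra.
split=> // phi phi_incr.
have lam1_ge0 k : 0 <= lam 1%N (phi k).
  by have [|[/ltW]] := bounds n (phi k); rewrite ?leqnn ?andbT ?(ltnW hn).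
have [bnd|unbnd] := pselect (bounded_fun (fun k => lam 1%N (phi k))).
  exists id => //; left; split=> // j j2n.
  apply: cvg_comp (lamj_toy j j2n); exact: homo_ltn_cvg.
have [psi psi_incr lam1_toy] := unbounded_subseq lam1_ge0 unbnd.
exists psi => //; right=> j j1n.
apply: ger_cvgy lam1_toy; apply: nearW => k.
have [->//|j1] := eqVneq j 1%N.
have [|[]//] := bounds j (phi (psi k)).
by case: j j1n j1 => [|[]].
Qed.
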